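(* Let $N,m$ be positive integers, let $0<\beta<1/(N+1)$, and let $\mathbf{t}=(t_0,t_1,\ldots,t_m)\in T^{m+1}$ with $0=t_0<t_1<\cdots<t_m$. The following statements are equivalent: (i) $\mathbf{t}$ is an admissible translation vector; (ii) the directed graph $G_{\mathbf{t}}$ has no cycle; (iii) the adjacency matrix $A_{\mathbf{t}}$ of $G_{\mathbf{t}}$ is nilpotent.
   Context: Let $T=\bigcup_{n=1}^\infty\big\{\frac{1-\beta}{N}\sum_{k=1}^n j_k\beta^{-k}: j_k\in\{0,1,\ldots,N\}\ \forall\,1\le k\le n\big\}$. For $\mathbf{t}=(t_0,\ldots,t_m)\in T^{m+1}$ with $0=t_0<t_1<\cdots<t_m$, let $\tau=\tau_{\mathbf{t}}$ be the smallest positive integer such that every $t_j$ ($0\le j\le m$) can be written as $t_j=\frac{1-\beta}{N}\sum_{k=1}^{\tau}t_{j,k}\beta^{-k}$ with $t_{j,k}\in\{0,1,\ldots,N\}$ (the digits $t_{j,k}$ are unique since $\beta<1/(N+1)$). Put $s_k=\max_{0\le j\le m}t_{j,k}$ for $1\le k\le\tau$. Define $\Omega_{\mathbf{t}}^{\tau}=\{i_1\cdots i_\tau\in\{0,\ldots,N\}^\tau: i_{\tau+1-k}\le N-s_k \text{ for }1\le k\le\tau\}$ and $\hat\Omega_{\mathbf{t}}^{\tau}=\{i_1\cdots i_\tau\in\{0,\ldots,N\}^\tau: i_{\tau+1-k}\ge s_k\text{ for }1\le k\le\tau\}$. Define the sets of words $\mathcal{A}_{\mathbf{t}}^{\tau}=\{(i_1+t_{j,\tau})(i_2+t_{j,\tau-1})\cdots(i_\tau+t_{j,1}):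 i_1\cdots i_\tau\in\Omega_{\mathbf{t}}^\tau,\ 0\le j\le m\}$, $\hat{\mathcal{A}}_{\mathbf{t}}^{\tau}=\{(i_1-t_{j,\tau})(i_2-t_{j,\tau-1})\cdots(i_\tau-t_{j,1}): i_1\cdots i_\tau\in\hat\Omega_{\mathbf{t}}^\tau,\ 0\le j\le m\}$, and $\mathcal{W}_{\mathbf{t}}^{\tau}=\mathcal{A}_{\mathbf{t}}^\tau\cup\hat{\mathcal{A}}_{\mathbf{t}}^\tau\subset\{0,\ldots,N\}^\tau$. A vector $\mathbf{t}\in\mathbb{R}^{m+1}$ with $0=t_0<t_1<\cdots<t_m$ is an admissible translation vector if $\mathbf{t}\in T^{m+1}$ and there exists $\ell\ge\tau_{\mathbf{t}}$ such that $\bigcup_{n=\tau_{\mathbf{t}}}^{\ell}\{0,\ldots,N\}^{n-\tau_{\mathbf{t}}}\times\mathcal{W}_{\mathbf{t}}^{\tau_{\mathbf{t}}}\times\{0,\ldots,N\}^{\ell-n}=\{0,\ldots,N\}^\ell$ (products meaning concatenation of words). The directed graph $G_{\mathbf{t}}=(V_{\mathbf{t}},E_{\mathbf{t}})$ has vertex set $V_{\mathbf{t}}=\{0,\ldots,N\}^{\tau}\setminus\mathcal{W}_{\mathbf{t}}^{\tau}$, and there is a directed edge from $i_1\cdots i_\tau\in V_{\mathbf{t}}$ to $j_1\cdots j_\tau\in V_{\mathbf{t}}$ exactly when $i_2\cdots i_\tau=j_1\cdots j_{\tau-1}$ (loops are allowed; when $\tau=1$ the condition is vacuous). $G_{\mathbf{t}}$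 has a cycle if there is a directed path (with at least one edge) starting and ending at the same vertex; the empty graph has no cycles. $A_{\mathbf{t}}$ is the $0$-$1$ adjacency matrix of size $\#V_{\mathbf{t}}\times\#V_{\mathbf{t}}$ whose entry $1$ corresponds to a directed edge; it is nilpotent if $A_{\mathbf{t}}^\ell=0$ for some positive integer $\ell$ (the empty matrix is regarded as nilpotent). *)

(* Defs.v *)
From HB Require Import structures.
From mathcomp Require Import all_boot all_order all_algebra.
From mathcomp Require Import boolp classical_sets reals.

Set Implicit Arguments.
Unset Strict Implicit.
Unset Printing Implicit Defensive.

Import Order.TTheory GRing.Theory Num.Theory.

Local Open Scope ring_scope.

(** Words [i_1 ... i_n] and digit strings [j_1, ..., j_n] over {0, ..., N} are
    tuples over ['I_N.+1]; the component of (1-based) index [k.+1] is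
    [tnth _ k] with [k : 'I_n].  Since [n + 1 - k.+1 = (n - k.+1).+1], the
    index reversal [k |-> n + 1 - k] is [rev_ord] on ['I_n]. *)

Definition expansion (R : realType) (N : nat) (beta : R) (n : nat)
    (d : n.-tuple 'I_N.+1) : R :=
  (1 - beta) / N%:R * \sum_(k < n) (tnth d k)%:R * beta ^- k.+1.

Definition T_set (R : realType) (N : nat) (beta : R) : set R :=
  (\bigcup_(n in [set n | (0 < n)%N])
    range (@expansion R N beta n))%classic.

Section Translation.
Context (R : realType) (N m : nat) (beta : R) (t : 'I_m.+1 -> R).

Definition increasing_from_0 : Prop :=
  t ord0 = 0 /\ forall i j : 'I_m.+1, (i < j)%N -> t i < t j.

Definition expandable (n : nat) : bool :=
  (0 < n)%N && [forall j, exists d : n.-tuple 'I_N.+1, t j == expansion beta d].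

(** The value 0 is only taken when some [t j] is outside [T_set N beta]. *)
Definition tau : nat :=
  if pselect (exists n, expandable n) is left ex_n then ex_minn ex_n else 0%N.

(** [t_{j,1}, ..., t_{j,n}]; the default is only used if [t j] has no expansion
    of length [n].  For [0 < beta < 1 / (N + 1)] the choice is unique. *)
Definition digits (n : nat) (j : 'I_m.+1) : n.-tuple 'I_N.+1 :=
  odflt [tuple ord0 | _ < n]
    [pick d : n.-tuple 'I_N.+1 | t j == expansion beta d].

Definition digit (n : nat) (j : 'I_m.+1) (k : 'I_n) : nat :=
  tnth (digits n j) k.

Definition max_digit (n : nat) (k : 'I_n) : nat :=
  (\max_(j < m.+1) digit j k)%N.

Definition Omega (n : nat) : {set n.-tuple 'I_N.+1} :=
  [set w : n.-tuple 'I_N.+1 |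
    [forall k : 'I_n, tnth w (rev_ord k) <= N - max_digit k]%N].

Definition hat_Omega (n : nat) : {set n.-tuple 'I_N.+1} :=
  [set w : n.-tuple 'I_N.+1 |
    [forall k : 'I_n, max_digit k <= tnth w (rev_ord k)]%N].

Definition A_words (n : nat) : {set n.-tuple 'I_N.+1} :=
  [set v : n.-tuple 'I_N.+1 |
    [exists w in Omega n, exists j : 'I_m.+1, forall p : 'I_n,
      tnth v p == (tnth w p + digit j (rev_ord p))%N :> nat]].

(** On [hat_Omega] the truncated subtraction is a true one. *)
Definition hat_A_words (n : nat) : {set n.-tuple 'I_N.+1} :=
  [set v : n.-tuple 'I_N.+1 |
    [exists w in hat_Omega n, exists j : 'I_m.+1, forall p : 'I_n,
      tnth v p == (tnth w p - digit j (rev_ord p))%N :> nat]].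

Definition W_words (n : nat) : {set n.-tuple 'I_N.+1} :=
  A_words n :|: hat_A_words n.

End Translation.

Definition all_words (N n : nat) : set (seq 'I_N.+1) :=
  [set s | size s = n]%classic.
Arguments all_words : clear implicits.

Definition cat_words (N : nat) (A B : set (seq 'I_N.+1)) : set (seq 'I_N.+1) :=
  [set u ++ v | u in A & v in B]%classic.

Definition admissible (R : realType) (N m : nat) (beta : R)
    (t : 'I_m.+1 -> R) : Prop :=
  [/\ increasing_from_0 t, forall j, T_set N beta (t j) &
      exists2 l : nat, (tau N beta t <= l)%N &
        (\bigcup_(n in [set n | (tau N beta t <= n <= l)%N])
          cat_words
            (cat_words (all_words N (n - tau N beta t)%N)
              [set tval w | w in [set` W_words N beta t (tau N beta t)]])
            (all_words N (l - n)%N))%classic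
        = all_words N l].

Definition vertex (R : realType) (N m : nat) (beta : R)
    (t : 'I_m.+1 -> R) : finType :=
  {w : (tau N beta t).-tuple 'I_N.+1 | w \notin W_words N beta t (tau N beta t)}.

Definition edge (R : realType) (N m : nat) (beta : R) (t : 'I_m.+1 -> R) :
    rel (vertex N beta t) :=
  fun x y => behead (val x) == take (tau N beta t).-1 (val y) :> seq 'I_N.+1.
Arguments edge {R} N {m} beta t.

Definition has_cycle (V : eqType) (e : rel V) : Prop :=
  exists2 c : seq V, c != [::] & cycle e c.

Definition adjacency (R : realType) (V : finType) (e : rel V) : 'M[R]_#|V| :=
  \matrix_(i, j) (e (enum_val i) (enum_val j))%:R.

Definition nilpotent_mx (R : realType) (n : nat) (A : 'M[R]_n) : Prop :=
  exists2 l : nat, (0 < l)%N & A ^+ l = 0.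

(* Main.v *)
Require Import Defs.
From mathcomp Require Import all_boot all_order all_algebra.
From mathcomp Require Import boolp classical_sets reals.
Import Order.TTheory GRing.Theory Num.Theory.
Local Open Scope ring_scope.

(** Both equivalences pass through one finite statement about walks: there is
    a length [l] such that the graph has no walk with [l] edges.

    - A finite graph satisfies it iff it has no cycle: a cycle can be traversed
      for ever, while in an acyclic graph a walk never returns to a vertex, so
      it has fewer than [#|V|] edges ([acyclicP]).

    - The [(i, j)] entry of the [l]-th power of the adjacency matrix counts the
      walks with [l] edges from [i] to [j]; in characteristic zero the power
      vanishes iff there is no such walk ([expr_adjacency_eq0]).

    - The vertices are the words of length [n] outside a set [W], and the
      edges are those of a de Bruijn graph.  Sliding a window of width [n]
      along a word of length [n + l] which has no factor in [W] gives a walk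
      with [l] edges, and overlapping the vertices of a walk gives back such a
      word.  Hence every word of length [n + l] has a factor in [W] iff there
      is no walk with [l] edges ([unavoidable_walkless]), and the covering
      condition in the definition of admissibility says just that
      ([covering_unavoidable]).  This holds for every set [W] of words of any
      common length [n]. *)

(** * Walks in a finite graph *)

Section Walks.
Set Implicit Arguments.
Unset Strict Implicit.
Context (V : finType) (e : rel V).

Definition walkless (l : nat) : Prop :=
  forall x p, path e x p -> size p <> l.

Lemma walklessS l : walkless l -> walkless l.+1.
Proof.
move=> no_walk x [//|y p] /= /andP[_ /no_walk neq_p] [].
exact: neq_p.
Qed.

(** The part of a walk between two visits to the same vertex is a cycle. *)
Lemma acyclic_path_uniq (x : V) (p : seq V) :
  ~ has_cycle e -> path e x p -> uniq (x :: p).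
Proof.
move=> acyclic; elim: p x => [//|y p IHp] x xp.
rewrite cons_uniq IHp ?andbT; last by case/andP: xp.
apply/negP => /splitPr split_p; case: split_p xp => p1 p2 xp.
apply: acyclic; exists (x :: p1) => //=.
by move: xp; rewrite -cat_rcons cat_path => /andP[].
Qed.

Lemma has_cycle_walk l : has_cycle e -> exists x p, path e x p /\ size p = l.
Proof.
case=> [[//|x c] _ /= xc]; exists x.
(* The closed walks [x ... x] are the ones that can be prolonged at will. *)
suff [p [xp _ le_l_p]] : exists p, [/\ path e x p, last x p = x & l <= size p]%N.
  by exists (take l p); rewrite take_path // size_takel.
elim: l => [|l [p [xp last_p le_l_p]]]; first by exists [::].
exists (rcons c x ++ p); rewrite cat_path last_cat last_rcons xc xp last_p.
by split=> //; rewrite size_cat size_rcons addSn ltnS (leq_trans le_l_p) ?leq_addl.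
Qed.

Lemma acyclicP : ~ has_cycle e <-> exists l, walkless l.
Proof.
split=> [acyclic | [l no_walk] /(has_cycle_walk l)[x [p [xp]]]]; last exact: no_walk xp.
exists #|V| => x p /(acyclic_path_uniq acyclic)/card_uniqP /= card_xp size_p.
by have := max_card (mem (x :: p)); rewrite card_xp size_p ltnn.
Qed.

End Walks.

(** * Powers of the adjacency matrix *)

Section AdjacencyPowers.
Set Implicit Arguments.
Unset Strict Implicit.
Context (R : realType) (V : finType) (e : rel V).
Let A : 'M[R]_#|V| := adjacency R e.

Lemma exprS_adjacencyE l i j :
  (A ^+ l.+1) i j = \sum_k (e (enum_val i) (enum_val k))%:R * (A ^+ l) k j.
Proof.
by rewrite exprS -mulmxE mxE; apply: eq_bigr => k _; rewrite !mxE.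
Qed.

Lemma expr_adjacency_ge0 l i j : 0 <= (A ^+ l) i j.
Proof.
elim: l i => [|l IHl] i; first by rewrite expr0 mxE ler0n.
by rewrite exprS_adjacencyE sumr_ge0 // => k _; rewrite mulr_ge0.
Qed.

(** The entries count walks, but only their vanishing matters.  It is here
    that nonnegativity is used: distinct walks cannot cancel. *)
Lemma expr_adjacency_neq0P l i j :
  (A ^+ l) i j != 0 <->
  exists p, [/\ path e (enum_val i) p, last (enum_val i) p = enum_val j
              & size p = l].
Proof.
elim: l i => [|l IHl] i.
  rewrite expr0 mxE pnatr_eq0 eqb0 negbK; split=> [/eqP->|]; first by exists [::].
  by case=> p [_ last_p /size0nil p0]; apply/eqP/enum_val_inj; rewrite -last_p p0.
rewrite exprS_adjacencyE psumr_neq0; last first.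
  by move=> k _; rewrite mulr_ge0 ?expr_adjacency_ge0.
split=> [/hasP[k _ /=] | [[|y p] [//= /andP[e_iy yp] last_p [size_p]]]].
  rewrite lt_def mulf_eq0 negb_or pnatr_eq0 eqb0 negbK.
  case/andP=> /andP[e_ik /IHl[p [kp last_p size_p]]] _.
  by exists (enum_val k :: p); rewrite /= e_ik kp size_p.
apply/hasP; exists (enum_rank y); rewrite ?mem_index_enum //=.
rewrite enum_rankK e_iy mul1r lt_def expr_adjacency_ge0 andbT.
by apply/IHl; exists p; rewrite enum_rankK.
Qed.

Lemma expr_adjacency_eq0 l : A ^+ l = 0 <-> walkless e l.
Proof.
split=> [A0 x p xp size_p | no_walk].
  have /eqP[] : (A ^+ l) (enum_rank x) (enum_rank (last x p)) != 0.
    by apply/expr_adjacency_neq0P; exists p; rewrite !enum_rankK.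
  by rewrite A0 mxE.
apply/matrixP=> i j; rewrite [RHS]mxE; apply/eqP/negPn/negP.
by case/expr_adjacency_neq0P=> p [ip _]; apply: no_walk ip.
Qed.

Lemma nilpotent_adjacencyP :
  nilpotent_mx (adjacency R e) <-> exists l, walkless e l.
Proof.
split=> [[l _ /expr_adjacency_eq0] | [l no_walk]]; first by exists l.
by exists l.+1 => //; apply/expr_adjacency_eq0/walklessS.
Qed.

End AdjacencyPowers.

(** * Words and walks in a de Bruijn graph *)

Lemma behead_take_cons (T : Type) k (a : T) s :
  behead (take k (a :: s)) = take k.-1 s.
Proof. by case: k => [|k] //=; rewrite take0. Qed.

Lemma take_cons_take_pred (T : Type) k (a : T) s :
  take k (a :: take k.-1 s) = take k (a :: s).
Proof. by case: k => [|k] //=; rewrite take_takel. Qed.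

Section DeBruijn.
Set Implicit Arguments.
Unset Strict Implicit.
Context (N n : nat) (W : {set n.-tuple 'I_N.+1}).

Let V : finType := {w : n.-tuple 'I_N.+1 | w \notin W}.

Definition overlap : rel V :=
  fun x y => behead (val x) == take n.-1 (val y) :> seq 'I_N.+1.

Definition has_factor (s : seq 'I_N.+1) : Prop :=
  exists u w v, w \in W /\ s = u ++ tval w ++ v.

Definition unavoidable (l : nat) : Prop :=
  forall s : seq 'I_N.+1, size s = (n + l)%N -> has_factor s.

Lemma has_factor_cons a s : has_factor s -> has_factor (a :: s).
Proof. by case=> u [w [v [wW ->]]]; exists (a :: u), w, v. Qed.

Lemma has_factor_consP a s : has_factor (a :: s) ->
  has_factor s \/ exists2 w, w \in W & tval w = take n (a :: s).
Proof.
case=> [[|b u] [w [v [wW def_s]]]]; last first.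
  by left; case: def_s => _ ->; exists u, w, v.
by right; exists w => //; rewrite def_s cat0s take_size_cat ?size_tuple.
Qed.

(** The vertices of the walk are the windows of width [n] along the word: two
    consecutive ones, [take n (a :: s)] and [take n s], share [take n.-1 s]. *)
Lemma walk_of_word l s : size s = (n + l)%N -> ~ has_factor s ->
  exists x p, [/\ path overlap x p, size p = l & tval (val x) = take n s].
Proof.
elim: l s => [|l IHl] s size_s avoid.
all: have window_s : size (take n s) == n by rewrite size_takel // size_s leq_addr.
all: have outside : Tuple window_s \notin W.
1,3: by apply/negP => sW; apply: avoid; exists [::], (Tuple window_s), (drop n s);
  rewrite /= cat_take_drop.
all: pose x : V := exist _ (Tuple window_s) outside.
  by exists x, [::].
case: s => [|a s] in size_s avoid window_s outside x *; first by rewrite addnS in size_s.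
have size_s' : size s = (n + l)%N by move: size_s; rewrite addnS => -[].
have [|y [p [yp size_p val_y]]] := IHl s size_s'.
  by move=> /(has_factor_cons a).
exists x, (y :: p); split=> //=; last by rewrite size_p.
by rewrite yp andbT /overlap val_y take_takel ?leq_pred // behead_take_cons.
Qed.

(** Prefixing the first letter of [x] is what prolongs the word of a walk by
    an initial edge from [x]; when [n = 0] the vertex has no letter and any one
    does. *)
Lemma word_of_walk x p : path overlap x p ->
  exists s, [/\ size s = (n + size p)%N, take n s = tval (val x) & ~ has_factor s].
Proof.
elim: p x => [|y p IHp] x /=.
  (* A factor of length [n] of the word [x] of length [n] is [x] itself. *)
  move=> _; exists (val x); split; rewrite ?addn0 ?size_tuple //.
    by rewrite take_oversize ?size_tuple.
  case=> u [w [v [wW def_x]]]; have := valP x; rewrite /=.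
  suff -> : val x = w by rewrite wW.
  have := congr1 size def_x; rewrite !size_cat !size_tuple => /eqP.
  rewrite addnCA -[X in X == _]addn0 eqn_add2l eq_sym addn_eq0 => /andP[].
  move=> /nilP u0 /nilP v0.
  by apply: val_inj; move: def_x; rewrite u0 v0 cats0.
case/andP=> /eqP e_xy /IHp[s [size_s take_s avoid]].
have take_as : take n (head ord0 (val x) :: s) = val x.
  rewrite -take_cons_take_pred -(take_takel s (leq_pred n)) take_s -e_xy.
  case: (tval (val x)) (size_tuple (val x)) => [<- //|a r size_r].
  by rewrite take_oversize // size_r.
exists (head ord0 (val x) :: s); split=> //; first by rewrite /= size_s addnS.
case/has_factor_consP=> // -[w wW]; rewrite take_as => /val_inj def_w.
by have := valP x; rewrite /= -def_w wW.
Qed.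

Lemma unavoidable_walkless l : unavoidable l <-> walkless overlap l.
Proof.
split=> [unav x p /word_of_walk[s [size_s _ avoid]] size_p | no_walk s size_s].
  by apply: avoid; apply: unav; rewrite size_s size_p.
apply: contrapT => /(walk_of_word size_s)[x [p [xp size_p _]]].
exact: no_walk xp size_p.
Qed.

(** A factor [w] of a word of length [n + l] is recorded by the index [k] at
    which it ends, which lies between [n] and [n + l]. *)
Lemma covering_unavoidable l :
  ((\bigcup_(k in [set k | (n <= k <= n + l)%N])
      cat_words
        (cat_words (all_words N (k - n)%N) [set tval w | w in [set` W]])
        (all_words N (n + l - k)%N))%classic
    = all_words N (n + l)%N) <-> unavoidable l.
Proof.
split=> [cover s size_s | unav].
  have : all_words N (n + l)%N s by [].
  rewrite -cover => -[k _ [_ [u _ [_ [w wW <-] <-]] [v _ <-]]].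
  by exists u, w, v; rewrite catA.
rewrite eqEsubset; split=> [s [k /andP[le_nk le_kl]] | s size_s].
  case=> _ [u size_u [_ [w _ <-] <-]] [v size_v <-].
  rewrite /all_words /= in size_u size_v *.
  by rewrite !size_cat size_tuple size_u size_v subnK // subnKC.
have [u [w [v [wW def_s]]]] := unav s size_s.
have size_uwv : (size u + n + size v = n + l)%N.
  by rewrite -size_s def_s !size_cat size_tuple addnA.
exists (size u + n)%N; first by rewrite /= leq_addl -size_uwv leq_addr.
exists (u ++ w); last first.
  by exists v; [rewrite /all_words /= -size_uwv addKn | rewrite def_s catA].
by exists u; [rewrite /all_words /= addnK | exists (tval w) => //; exists w].
Qed.

End DeBruijn.

Theorem proposition1p3 (R : realType) (N m : nat) (beta : R)
    (t : 'I_m.+1 -> R)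
    (N_gt0 : (0 < N)%N) (m_gt0 : (0 < m)%N)
    (beta_gt0 : 0 < beta) (beta_lt : beta < 1 / (N%:R + 1))
    (t_T : forall j, T_set N beta (t j))
    (t_incr : increasing_from_0 t) :
  (admissible N beta t <-> ~ has_cycle (edge N beta t)) /\
  (~ has_cycle (edge N beta t) <->
   nilpotent_mx (adjacency R (edge N beta t))).
Proof.
rewrite acyclicP nilpotent_adjacencyP; split=> //.
pose W := W_words N beta t (tau N beta t).
have walkless_edge l : walkless (edge N beta t) l <-> unavoidable W l.
  by rewrite unavoidable_walkless.
split=> [[_ _ [l le_tau_l cover]] | [l /walkless_edge unav]].
  exists (l - tau N beta t)%N; apply/walkless_edge/covering_unavoidable.
  by rewrite subnKC.
split=> //; exists (tau N beta t + l)%N; first exact: leq_addr.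
exact/covering_unavoidable.
Qed.
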